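(* Let $A \subset \mathbb{Z}_{>0}$ be a set of size $4$ with co-prime elements (i.e. the greatest common divisor of all elements of $A$ is $1$). Then at least one of the following holds: (i) $m_A > 2/3$; (ii) $A = \{u, 2u, v, 2v\}$ for some $u, v \in \mathbb{Z}_{>0}$; (iii) $A$ is one of $\{1,2,3,4\}$, $\{1,2,4,5\}$, $\{1,4,5,8\}$, $\{2,3,5,10\}$.
   Context: Let $f:\mathbb{R}\to\mathbb{R}$ be the $1$-periodic function with $f(x) = 1_{[1/3,2/3)}(x) - 1/3$ for $x \in [0,1)$. For a finite set $A \subset \mathbb{Z}_{>0}$ put $f_A(x) = \sum_{a \in A} f(ax)$ and $m_A = \max_{x \in \mathbb{R}} f_A(x)$. *)

(* Defs.v *)
From HB Require Import structures.
From mathcomp Require Import all_boot all_order all_algebra finmap.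
From mathcomp Require Import mathcomp_extra boolp classical_sets functions.
From mathcomp Require Import set_interval reals numfun.

Set Implicit Arguments.
Unset Strict Implicit.
Unset Printing Implicit Defensive.
Import Order.TTheory GRing.Theory Num.Theory.
Local Open Scope classical_set_scope.
Local Open Scope ring_scope.

Definition fracpart (R : realType) (x : R) : R := x - (Num.floor x)%:~R.

Definition f (R : realType) (x : R) : R :=
  \1_(`[1 / 3, 2 / 3[%classic : set R) (fracpart x) - 1 / 3.

Definition fA (R : realType) (A : {fset nat}) (x : R) : R :=
  \sum_(a <- A) f (a%:R * x).

(* The maximum of fA over the reals, written as a supremum; it is attained,
   see mA_attained and fA_le_mA below. *)
Definition mA (R : realType) (A : {fset nat}) : R := sup (range (@fA R A)).

Definition gcd_fset (A : {fset nat}) : nat := \big[gcdn/0%N]_(a <- A) a.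

Lemma fE01 (R : realType) (x : R) : 0 <= x < 1 ->
  f x = \1_(`[1 / 3, 2 / 3[%classic : set R) x - 1 / 3.
Proof.
move=> x01; rewrite /f /fracpart.
have -> : Num.floor x = 0 by apply/floor_def; rewrite add0r.
by rewrite subr0.
Qed.

Lemma f_periodic (R : realType) (x : R) : f (x + 1) = f x.
Proof.
rewrite /f /fracpart floorDrz ?rpred1// floor1 intrD.
by rewrite opprD addrACA subrr addr0.
Qed.

Lemma fA_count (R : realType) (A : {fset nat}) (x : R) :
  exists2 k : nat, (k <= #|` A|)%N & fA A x = k%:R - #|` A|%:R / 3.
Proof.
pose P (a : nat) := fracpart (a%:R * x) \in (`[1 / 3, 2 / 3[%classic : set R).
exists (count P A); first exact: count_size.
rewrite /fA /f sumrB -sum1_count natr_sum.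
congr (_ - _).
  rewrite [RHS]big_mkcond; apply: eq_bigr => a _.
  by rewrite indicE -/(P a); case: (P a).
by rewrite big_const_seq count_predT iter_addr_0 div1r [RHS]mulr_natl.
Qed.

Lemma mA_max (R : realType) (A : {fset nat}) :
  exists2 x : R, fA A x = mA R A & forall y : R, fA A y <= mA R A.
Proof.
pose c : R := #|` A|%:R / 3.
pose P (k : nat) := `[< exists x : R, fA A x = k%:R - c >].
have exP : exists k, P k.
  by have [k _ e] := fA_count A (0 : R); exists k; apply/asboolP; exists 0.
have ubP k : P k -> (k <= #|` A|)%N.
  move=> /asboolP [x]; have [j jA ->] := fA_count A x.
  by move=> /addIr /eqP; rewrite eqr_nat => /eqP <-.
case: (ex_maxnP exP ubP) => k /asboolP [x0 e0] kmax.
have ub y : fA A y <= fA A x0.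
  have [j _ ej] := fA_count A y.
  rewrite e0 ej lerD2r ler_nat; apply: kmax; apply/asboolP.
  by exists y.
have eS : mA R A = fA A x0.
  apply/eqP; rewrite eq_le; apply/andP; split.
    by apply: ge_sup => [|_ [y _ <-]]; [exists (fA A x0); exists x0|].
  apply: ub_le_sup; last by exists x0.
  by exists (fA A x0) => _ [y _ <-].
by exists x0 => // y; rewrite eS.
Qed.

Lemma mA_attained (R : realType) (A : {fset nat}) :
  exists x : R, fA A x = mA R A.
Proof. by have [x] := mA_max R A; exists x. Qed.

Lemma fA_le_mA (R : realType) (A : {fset nat}) (x : R) : fA A x <= mA R A.
Proof. by have [? _] := mA_max R A. Qed.

(* Main.v *)
(* Since f_A = k - 4/3, where k counts the a in A with a x in [1/3, 2/3) mod 1,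
   it suffices to find x for which three of the four multiples lie in
   [1/3, 2/3) mod 1; call such a triple hit.  A triple a < b < c is hit unless
   a + b = c, or one element is the double of another, or the triple is
   proportional to (1, 5, 8) or (2, 3, 10).

   To see this, let p, q, r be a permutation of a coprime triple and restrict
   to x in Z / (p + q), where q x = - p x.  If gcd(p, q) = 1 then p x = j / m
   with m = p + q and r x = rho j / m for a fixed residue rho.  As j runs over
   the middle third of the residues mod m, the points rho j / m, or those with
   j even, walk around the circle in steps of length at most 1/3 and enter
   [1/3, 2/3), unless 2 rho is 0, 1, -1, 4 or -4 mod m, that is,
   2 r = s p + k (p + q) with s among these values.  A common divisor g of p
   and q allows in addition a shift of r x by 1 / g, which only helps.
   Applying this to the pairs (a, c) and (b, c) gives two linear relations with
   few solutions.  The argument needs p + q >= 60; the triples with c < 60 are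
   checked by computation.  Finally, a set of four elements none of whose
   triples is hit satisfies a system of linear equations whose solutions are
   the sets in the theorem. *)

Require Import Defs.
From Stdlib Require Import ZArith Znumtheory Lia.
From mathcomp Require Import all_boot all_order all_algebra finmap.
From mathcomp Require Import zify lra classical_sets reals numfun.
Import Order.TTheory GRing.Theory Num.Theory.
Local Open Scope fset_scope.
Local Open Scope Z_scope.

(* The fractional part of y / N lies in [1/3, 2/3). *)
Definition mid (N y : Z) : Prop := exists u, N <= 3 * (y - u * N) < 2 * N.

Definition hit (a b c : Z) : Prop :=
  exists N K, 0 < N /\ mid N (K * a) /\ mid N (K * b) /\ mid N (K * c).

(** * Arithmetic progressions modulo [m] and the middle third *)

Lemma step_to (x T L : Z) : 0 < T -> 3 * x <= L ->
  exists i, 0 <= i /\ L <= 3 * (x + i * T) < L + 3 * T.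
Proof.
intros T0 xL; exists ((L - 3 * x + 3 * T - 1) / (3 * T)).
pose proof (Z.div_mod (L - 3 * x + 3 * T - 1) (3 * T) ltac:(lia)).
pose proof (Z.mod_pos_bound (L - 3 * x + 3 * T - 1) (3 * T) ltac:(lia)).
split; [apply Z.div_pos; lia | lia].
Qed.

(** A step of at most [m / 3] cannot jump over the middle third, and the gap between two copies of
    it has length [2 * m / 3], which [n] steps cover. *)
Lemma walk_up_mid (m x T n : Z) : 0 < T -> 3 * T <= m -> 2 * m <= 3 * (n * T) ->
  exists i, 0 <= i <= n /\ mid m (x + i * T).
Proof.
intros T0 Tm nT.
assert (m0 : 0 < m) by lia.
pose proof (Z.div_mod x m ltac:(lia)) as ex.
pose proof (Z.mod_pos_bound x m m0) as bx.
set (w := x mod m) in *; set (d := x / m) in *.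
destruct (Z_le_gt_dec (3 * w) m) as [h | h].
  destruct (step_to w T m T0 h) as [i [i0 hi]].
  exists i; split; [nia | exists d; nia].
destruct (Z_lt_ge_dec (3 * w) (2 * m)) as [h' | h'].
  exists 0; split; [nia | exists d; lia].
(* Past the middle third, the walk aims for its next copy, which starts at [4 * m / 3]. *)
destruct (step_to w T (4 * m) T0 ltac:(lia)) as [i [i0 hi]].
exists i; split; [nia | exists (d + 1); nia].
Qed.

Lemma walk_mid (m x T n : Z) : T <> 0 -> 3 * Z.abs T <= m ->
  2 * m <= 3 * (n * Z.abs T) -> exists i, 0 <= i <= n /\ mid m (x + i * T).
Proof.
intros T0 Tm nT; destruct (Z_lt_ge_dec 0 T) as [h | h].
  rewrite -> (Z.abs_eq T) in Tm, nT by lia; now apply walk_up_mid.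
rewrite -> (Z.abs_neq T) in Tm, nT by lia.
destruct (walk_up_mid m (x + n * T) (- T) n ltac:(lia) Tm nT) as [i [hi [u hu]]].
exists (n - i); split; [lia | exists u].
now replace (x + (n - i) * T) with (x + n * T + i * - T) by ring.
Qed.

Lemma nmid_intro (m y u : Z) : 2 * m <= 3 * (y - u * m) < 4 * m -> ~ mid m y.
Proof.
intros hu [v hv].
assert (v <= u \/ u + 1 <= v) as [h | h] by lia; nia.
Qed.

(** The roles are exchanged: the target has length [2 * m / 3], more than a step, and only the
    middle third, of length [m / 3], has to be crossed. *)
Lemma walk_up_nmid (m x T n : Z) : 0 < T -> 2 * T <= m -> m <= 3 * (n * T) ->
  exists i, 0 <= i <= n /\ ~ mid m (x + i * T).
Proof.
intros T0 Tm nT.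
assert (m0 : 0 < m) by lia.
pose proof (Z.div_mod x m ltac:(lia)) as ex.
pose proof (Z.mod_pos_bound x m m0) as bx.
set (w := x mod m) in *; set (d := x / m) in *.
destruct (Z_lt_ge_dec (3 * w) m) as [h | h].
  exists 0; split; [nia | apply (nmid_intro _ _ (d - 1)); lia].
destruct (Z_le_gt_dec (3 * w) (2 * m)) as [h' | h'].
  destruct (step_to w T (2 * m) T0 h') as [i [i0 hi]].
  exists i; split; [nia | apply (nmid_intro _ _ d); lia].
exists 0; split; [nia | apply (nmid_intro _ _ d); lia].
Qed.

Lemma walk_nmid (m x T n : Z) : T <> 0 -> 2 * Z.abs T <= m ->
  m <= 3 * (n * Z.abs T) -> exists i, 0 <= i <= n /\ ~ mid m (x + i * T).
Proof.
intros T0 Tm nT; destruct (Z_lt_ge_dec 0 T) as [h | h].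
  rewrite -> (Z.abs_eq T) in Tm, nT by lia; now apply walk_up_nmid.
rewrite -> (Z.abs_neq T) in Tm, nT by lia.
destruct (walk_up_nmid m (x + n * T) (- T) n ltac:(lia) Tm nT) as [i [hi hu]].
exists (n - i); split; [lia |].
now replace (x + (n - i) * T) with (x + n * T + i * - T) by ring.
Qed.

(** * Slices modulo [p + q] *)

Lemma centered_residue (m y : Z) : 0 < m ->
  exists rho n, y = rho + n * m /\ 2 * Z.abs rho <= m.
Proof.
intros m0.
pose proof (Z.div_mod y m ltac:(lia)).
pose proof (Z.mod_pos_bound y m m0).
destruct (Z_le_gt_dec (2 * (y mod m)) m).
  exists (y mod m), (y / m); lia.
exists (y mod m - m), (y / m + 1); lia.
Qed.

(* At x = K / (g m) the multiples p' g x and q' g x are opposite mod 1; as K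
   varies, p' g x runs over all j / m and, for j fixed, r x runs over a full
   coset of the multiples of 1 / g. *)
Lemma hit_of_slice (g m p' q' r e z f y rho n j h : Z) :
  0 < g -> 0 < m -> p' + q' = m -> e * p' = 1 + z * m -> r * f = 1 + y * g ->
  r * e = rho + n * m -> m < 3 * j < 2 * m -> mid (g * m) (j * rho + m * h) ->
  hit (g * p') (g * q') r.
Proof.
intros g0 m0 em ez ey er hj [u hu].
(* The first summand makes the multiple of [p'] congruent to [j] mod [m]; the second, a multiple of
   [m], corrects that of [r] mod [g * m], as [f] inverts [r] mod [g]. *)
exists (g * m), (e * j + f * (h - j * n) * m).
set (i := f * (h - j * n)).
assert (eK : (e * j + i * m) * p' = j + (j * z + i * p') * m).
  transitivity (j * (e * p') + i * p' * m); [ring | rewrite ez; ring].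
split; [nia | split; [| split]].
- exists (j * z + i * p').
  replace ((e * j + i * m) * (g * p')) with (g * ((e * j + i * m) * p')) by ring.
  rewrite eK.
  replace (g * (j + (j * z + i * p') * m) - (j * z + i * p') * (g * m))
    with (g * j) by ring.
  nia.
- exists (e * j + i * m - (j * z + i * p') - 1).
  replace q' with (m - p') by lia.
  replace ((e * j + i * m) * (g * (m - p')))
    with (g * ((e * j + i * m) * m - (e * j + i * m) * p')) by ring.
  rewrite eK.
  replace (g * ((e * j + i * m) * m - (j + (j * z + i * p') * m)) -
    (e * j + i * m - (j * z + i * p') - 1) * (g * m)) with (g * (m - j)) by ring.
  nia.
- exists (u + (h - j * n) * y).
  replace ((e * j + i * m) * r) with (j * (r * e) + (h - j * n) * m * (r * f))
    by (unfold i; ring).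
  rewrite er ey.
  replace (j * (rho + n * m) + (h - j * n) * m * (1 + y * g) -
     (u + (h - j * n) * y) * (g * m)) with (j * rho + m * h - u * (g * m)) by ring.
  exact hu.
Qed.

Lemma slice_mid (m rho : Z) : 60 <= m -> 2 * Z.abs rho <= m ->
  (exists j, m < 3 * j < 2 * m /\ mid m (j * rho)) \/
  exists s d, (s = 0 \/ Z.abs s = 1 \/ Z.abs s = 4) /\ 2 * rho = s + d * m.
Proof.
intros m60 hr.
pose proof (Z.div_mod m 3 ltac:(lia)).
pose proof (Z.mod_pos_bound m 3 ltac:(lia)).
pose proof (Z.div_mod m 6 ltac:(lia)).
pose proof (Z.mod_pos_bound m 6 ltac:(lia)).
pose proof (Z.div_mod (m - 1) 3 ltac:(lia)).
pose proof (Z.mod_pos_bound (m - 1) 3 ltac:(lia)).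
set (l := (m - 1) / 3) in *; set (m3 := m / 3) in *; set (m6 := m / 6) in *.
destruct (Z_le_gt_dec (3 * Z.abs rho) m) as [h | h].
  assert (3 <= Z.abs rho \/ Z.abs rho = 1 \/ rho = 0 \/ Z.abs rho = 2) as [h3|[h1|[h0|h2]]]
    by lia.
  - left; destruct (walk_mid m ((m3 + 1) * rho) rho (m3 - 2)
    ltac:(lia) ltac:(lia) ltac:(nia)) as [i [hi hm]].
    exists (m3 + 1 + i); split; [lia|].
    now replace ((m3 + 1 + i) * rho) with ((m3 + 1) * rho + i * rho) by ring.
  - left; exists (m3 + 1); split; [lia|].
    assert (rho = 1 \/ rho = -1) as [-> | ->] by lia; [exists 0 | exists (-1)]; lia.
  - right; exists 0, 0; lia.
  - right; exists (2 * rho), 0; lia.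
(* For even [j = 2 * i] the point [j * rho] is [i * t] mod [m], with a short step [t]. *)
assert (exists t d, 2 * rho = t + d * m /\ 3 * Z.abs t < m /\ Z.abs d = 1) as [t [d [et [ht hd]]]].
  destruct (Z_le_gt_dec 0 rho).
    exists (2 * rho - m), 1; lia.
  exists (2 * rho + m), (-1); lia.
assert (dbl : forall i, m < 6 * i < 2 * m -> mid m (i * t) ->
   exists j, m < 3 * j < 2 * m /\ mid m (j * rho)).
  intros i hi [u hu]; exists (2 * i); split; [lia | exists (u + i * d)].
  replace (2 * i * rho - (u + i * d) * m) with (i * (2 * rho) - i * d * m - u * m) by ring.
  rewrite et; replace (i * (t + d * m) - i * d * m - u * m) with (i * t - u * m) by ring.
  exact hu.
assert (5 <= Z.abs t \/ Z.abs t = 2 \/ Z.abs t = 3 \/ (t = 0 \/ Z.abs t = 1 \/ Z.abs t = 4))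
  as [h5|[h2|[h3|h014]]] by lia.
(* There are at least [m / 6 - 2] steps. With length at least 5 they cover [2 * m / 3] once
   [m >= 60], the source of that bound; length 4 always falls short. *)
- left; destruct (walk_mid m ((m6 + 1) * t) t (l - m6 - 1)
    ltac:(lia) ltac:(lia) ltac:(nia)) as [i [hi hm]].
  apply (dbl (m6 + 1 + i)); [lia|].
  now replace ((m6 + 1 + i) * t) with ((m6 + 1) * t + i * t) by ring.
(* Here the first point already works: [i] just above [m / 6] puts [i * t] near a third or a half of
   [m], up to sign. *)
- left; apply (dbl (m6 + 1)); [lia|].
  assert (t = 2 \/ t = -2) as [-> | ->] by lia; [exists 0 | exists (-1)]; lia.
- left; apply (dbl (m6 + 1)); [lia|].
  assert (t = 3 \/ t = -3) as [-> | ->] by lia; [exists 0 | exists (-1)]; lia.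
- right; exists t, d; tauto.
Qed.

(** Serves [g = 2], where points outside the middle third are wanted: a shift by a multiple of [m]
    brings them into the middle third mod [2 * m]. *)
Lemma slice_nmid (m rho : Z) : 18 <= m -> 2 * Z.abs rho <= m ->
  (exists j, m < 3 * j < 2 * m /\ ~ mid m (j * rho)) \/ Z.abs rho = 1.
Proof.
intros m12 hr.
pose proof (Z.div_mod m 3 ltac:(lia)).
pose proof (Z.mod_pos_bound m 3 ltac:(lia)).
set (m3 := m / 3) in *.
assert (2 <= Z.abs rho \/ Z.abs rho = 1 \/ rho = 0) as [h2|[h1| ->]] by lia.
- left; destruct (walk_nmid m ((m3 + 1) * rho) rho (m3 - 2)
    ltac:(lia) ltac:(lia) ltac:(nia)) as [i [hi hm]].
  exists (m3 + 1 + i); split; [lia|].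
  now replace ((m3 + 1 + i) * rho) with ((m3 + 1) * rho + i * rho) by ring.
- now right.
- left; exists (m3 + 1); split; [lia|]; rewrite Z.mul_0_r; apply (nmid_intro _ _ (-1)); lia.
Qed.

Lemma mid_double_shift (m v : Z) : 0 < m -> ~ mid m v -> exists h, mid (2 * m) (v + m * h).
Proof.
intros m0 nv.
pose proof (Z.div_mod v m ltac:(lia)).
pose proof (Z.mod_pos_bound v m m0).
set (w := v mod m) in *; set (d := v / m) in *.
destruct (Z_lt_ge_dec (3 * w) m) as [h | h].
  exists (1 - d), 0; nia.
destruct (Z_lt_ge_dec (3 * w) (2 * m)) as [h' | h'].
  destruct nv; exists d; lia.
exists (- d), 0; nia.
Qed.

Lemma mid_shift (g m v : Z) : 0 < m -> 3 <= g -> exists h, mid (g * m) (v + m * h).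
Proof.
intros m0 g3.
pose proof (Z.div_mod (3 * v - g * m) (3 * m) ltac:(lia)).
pose proof (Z.mod_pos_bound (3 * v - g * m) (3 * m) ltac:(lia)).
exists (- ((3 * v - g * m) / (3 * m))), 0; nia.
Qed.

Lemma pair_hit_or_relation (p q r : Z) :
  0 < p -> 0 < q -> p <> q -> q <> 2 * p -> p <> 2 * q -> 60 <= p + q ->
  Z.gcd (Z.gcd p q) r = 1 ->
  hit p q r \/ exists s k, (s = 0 \/ Z.abs s = 1 \/ Z.abs s = 4) /\ 2 * r = s * p + k * (p + q).
Proof.
intros p0 q0 pq q2p p2q pq60 gcd1.
assert (g0 : 0 < Z.gcd p q).
  pose proof (Z.gcd_nonneg p q); pose proof (Z.gcd_eq_0_l p q); lia.
destruct (Z.gcd_divide_l p q) as [p' hp]; destruct (Z.gcd_divide_r p q) as [q' hq].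
assert (cop : Z.gcd p' q' = 1).
  pose proof (Z.gcd_mul_mono_l_nonneg p' q' (Z.gcd p q) ltac:(lia)) as e.
  rewrite (Z.mul_comm _ p') (Z.mul_comm _ q') -hp -hq in e; nia.
set (g := Z.gcd p q) in *.
destruct (rel_prime_bezout p' q') as [e e' he].
  apply Zgcd_1_rel_prime; exact cop.
destruct (rel_prime_bezout g r) as [y f hf].
  apply Zgcd_1_rel_prime; exact gcd1.
set (m := p' + q').
assert (hm : 0 < m) by (unfold m; nia).
assert (em : p + q = g * m) by (unfold m; lia).
(* Since [q'] is [- p'] mod [m], the Bezout coefficients make [e - e'] an inverse of [p'] mod
   [m]. *)
destruct (centered_residue m (r * (e - e')) hm) as [rho [n [er hr]]].
assert (ez : (e - e') * p' = 1 + (- e') * m) by (unfold m; lia).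
assert (ey : r * f = 1 + (- y) * g) by lia.
assert (slice : forall j h, m < 3 * j < 2 * m -> mid (g * m) (j * rho + m * h) -> hit p q r).
  intros j h hj hmid; rewrite hp hq (Z.mul_comm p') (Z.mul_comm q').
  exact (hit_of_slice g m p' q' r _ _ f _ rho n j h g0 hm erefl ez ey er hj hmid).
assert (rel : exists k', r = rho * p' + k' * m).
  exists (n * p' + r * e').
  transitivity (r * (e - e') * p' + r * e' * m); [| rewrite er; ring].
  replace (r * (e - e') * p') with (r * ((e - e') * p')) by ring.
  rewrite ez; ring.
destruct rel as [k' ek].
assert (g = 1 \/ g = 2 \/ 3 <= g) as [g1|[g2|g3]] by lia.
- destruct (slice_mid m rho ltac:(nia) hr) as [[j [hj hmid]] | [s [d [hs es]]]].
    left; apply (slice j 0 hj); rewrite g1 Z.mul_1_l Z.mul_0_r Z.add_0_r; exact hmid.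
  right; exists s, (d * p' + 2 * k'); split; [exact hs|].
  rewrite em g1 hp g1 ek.
  transitivity (2 * rho * p' + 2 * k' * m); [ring | rewrite es; ring].
- destruct (slice_nmid m rho ltac:(nia) hr) as [[j [hj nmid]] | hs].
    destruct (mid_double_shift m (j * rho) hm nmid) as [h hh].
    left; apply (slice j h hj); rewrite g2; exact hh.
  right; exists rho, k'; split; [tauto|].
  rewrite em g2 hp g2 ek; ring.
- left.
  assert (p'0 : 0 < p') by nia.
  assert (q'0 : 0 < q') by nia.
  (* The excluded ratios of [p] and [q] leave [m >= 4]; for [m = 3] no [j] lies strictly between
     [m / 3] and [2 * m / 3]. *)
  assert (m4 : 4 <= m).
    assert (p' <> q') by (intros e0; rewrite e0 in hp; lia).
    assert (q' <> 2 * p') by (intros e0; rewrite e0 in hq; lia).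
    assert (p' <> 2 * q') by (intros e0; rewrite e0 in hp; lia).
    unfold m; lia.
  pose proof (Z.div_mod m 3 ltac:(lia)).
  pose proof (Z.mod_pos_bound m 3 ltac:(lia)).
  destruct (mid_shift g m ((m / 3 + 1) * rho) hm g3) as [h hh].
  apply (slice (m / 3 + 1) h ltac:(lia) hh).
Qed.

(** * Scaling, exceptional triples and the finite check *)

Lemma mid_scale (g N y : Z) : 0 < g -> mid N y -> mid (g * N) (g * y).
Proof. intros g0 [u hu]; exists u; nia. Qed.

Lemma hit_scale (g a b c : Z) : 0 < g -> hit a b c -> hit (a * g) (b * g) (c * g).
Proof.
intros g0 [N [K [N0 [ha [hb hc]]]]].
exists (g * N), K; split; [nia|].
rewrite !(Z.mul_comm _ g) !Z.mul_assoc !(Z.mul_comm K g) -!Z.mul_assoc.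
now split; [|split]; apply mid_scale.
Qed.

Lemma hit_swap (a b c : Z) : hit a c b -> hit a b c.
Proof. intros [N [K H]]; exists N, K; tauto. Qed.

Lemma hit_rot (a b c : Z) : hit b c a -> hit a b c.
Proof. intros [N [K H]]; exists N, K; tauto. Qed.

Definition exceptional (a b c : Z) : Prop :=
  a + b = c \/ b = 2 * a \/ c = 2 * b \/ c = 2 * a \/
  (b = 5 * a /\ c = 8 * a) \/ (2 * b = 3 * a /\ c = 5 * a).

Definition exceptionalb (a b c : Z) : bool :=
  (a + b =? c) || (b =? 2 * a) || (c =? 2 * b) || (c =? 2 * a) ||
  ((b =? 5 * a) && (c =? 8 * a)) || ((2 * b =? 3 * a) && (c =? 5 * a)).

Definition midb (N y : Z) : bool :=
  let w := y mod N in (N <=? 3 * w) && (3 * w <? 2 * N).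

Lemma midb_mid (N y : Z) : 0 < N -> midb N y -> mid N y.
Proof.
intros N0; unfold midb; cbv zeta; intros h; exists (y / N).
pose proof (Z.div_mod y N ltac:(lia)); lia.
Qed.

Definition hit_atb (a b c N K : Z) : bool :=
  if midb N (K * a) then if midb N (K * b) then midb N (K * c) else false else false.

Fixpoint hit_belowb (a b c d : Z) (n : nat) : bool :=
  match n with
  | O => false
  | S n' => if hit_atb a b c (3 * d) (3 * Z.of_nat n' + 1) then true
            else hit_belowb a b c d n'
  end.

(* If a triple is hit at all, it is hit at a left endpoint (k + 1/3) / d of
   one of the intervals of one of its elements d.  Conditionals replace the
   boolean connectives because vm_compute evaluates the latter eagerly. *)
Definition hitb (a b c : Z) : bool :=
  if hit_belowb a b c c (Z.to_nat c) then true
  else if hit_belowb a b c b (Z.to_nat b) then true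
  else hit_belowb a b c a (Z.to_nat a).

Lemma hit_belowb_hit (a b c d : Z) (n : nat) : 0 < d -> hit_belowb a b c d n -> hit a b c.
Proof.
intros d0; elim: n => [//|n IHn]; rewrite [hit_belowb _ _ _ _ _]/=.
case: ifP => [E _|_ /IHn //].
exists (3 * d), (3 * Z.of_nat n + 1); split; [lia|].
move: E; rewrite /hit_atb.
case Ea: (midb _ _) => //; case Eb: (midb _ _) => // Ec.
by split; [|split]; apply: midb_mid => //; lia.
Qed.

Lemma hitb_hit (a b c : Z) : 0 < a -> 0 < b -> 0 < c -> hitb a b c -> hit a b c.
Proof.
intros a0 b0 c0; rewrite /hitb.
case: ifP => [/hit_belowb_hit h _|_]; first exact: h.
case: ifP => [/hit_belowb_hit h _|_]; first exact: h.
exact: hit_belowb_hit.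
Qed.

Lemma small_triples :
  all (fun c => all (fun b => all (fun a => (0 < a)%N ==>
    let A := Z.of_nat a in let B := Z.of_nat b in let C := Z.of_nat c in
    if exceptionalb A B C then true else hitb A B C) (iota 0 b)) (iota 0 c)) (iota 0 60).
Proof. vm_compute; reflexivity. Qed.

Lemma small_triple_hit (a b c : Z) : 0 < a < b -> b < c < 60 ->
  hit a b c \/ exceptional a b c.
Proof.
intros hab hbc.
have /allP/(_ (Z.to_nat c)) := small_triples; rewrite mem_iota.
move=> /(_ ltac:(lia)) /allP /(_ (Z.to_nat b)); rewrite mem_iota.
move=> /(_ ltac:(lia)) /allP /(_ (Z.to_nat a)); rewrite mem_iota.
move=> /(_ ltac:(lia)) /implyP /(_ ltac:(lia)); cbv zeta.
rewrite !Z2Nat.id; try lia.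
case: ifP => [h _|_ /hitb_hit h]; [right | left; apply h; lia].
unfold exceptionalb in h; unfold exceptional; lia.
Qed.

(** * Solving the two linear relations *)

Lemma between_multiples (m k l u : Z) : 0 < m -> l * m < k * m < u * m -> l < k < u.
Proof. intros m0 h; split; apply (Z.mul_lt_mono_pos_r m); lia. Qed.

(** Size bounds on [2 * b - s * a] leave at most two values of [k] for each [s]; three of the
    resulting relations are exceptional. *)
Lemma middle_relation (a b c s k : Z) : 0 < a < b -> b < c ->
  s = 0 \/ Z.abs s = 1 \/ Z.abs s = 4 -> 2 * b = s * a + k * (a + c) ->
  c = 2 * b \/ b = 2 * a \/ a + b = c \/
  2 * b = a + c \/ 2 * b = 2 * a + c \/ 2 * b = 5 * a + c \/ 2 * b = c - 3 * a.
Proof.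
intros hab hbc hs.
pose proof (between_multiples (a + c) k) as bm.
assert (s = 0 \/ s = 1 \/ s = -1 \/ s = 4 \/ s = -4) as [->|[->|[->|[->| ->]]]]
  by lia; intros e; clear hs.
- assert (k = 1) as -> by (pose proof (bm 0 2); lia); lia.
- assert (k = 1) as -> by (pose proof (bm 0 2); lia); lia.
- assert (k = 1) as -> by (pose proof (bm 0 2); lia); lia.
- assert (k = 0 \/ k = 1) as [-> | ->] by (pose proof (bm (-1) 2); lia); lia.
- assert (k = 1 \/ k = 2) as [-> | ->] by (pose proof (bm 0 3); lia); lia.
Qed.

Lemma lower_relation (a b c s k : Z) : 0 < a < b -> b < c ->
  s = 0 \/ Z.abs s = 1 \/ Z.abs s = 4 -> 2 * a = s * b + k * (b + c) ->
  b = 2 * a \/ c = 2 * a \/ a + b = c \/ 2 * a = 3 * b - c \/ 2 * a = c - 3 * b.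
Proof.
intros hab hbc hs.
pose proof (between_multiples (b + c) k) as bm.
assert (s = 0 \/ s = 1 \/ s = -1 \/ s = 4 \/ s = -4) as [->|[->|[->|[->| ->]]]]
  by lia; intros e; clear hs.
- pose proof (bm 0 1); lia.
- assert (k = 0) as -> by (pose proof (bm (-1) 1); lia); lia.
- assert (k = 1) as -> by (pose proof (bm 0 2); lia); lia.
- assert (k = -1) as -> by (pose proof (bm (-2) 0); lia); lia.
- assert (k = 1 \/ k = 2) as [-> | ->] by (pose proof (bm 0 3); lia); lia.
Qed.

Lemma coprime_triple_hit (a b c : Z) : 0 < a < b -> b < c ->
  Z.gcd (Z.gcd a c) b = 1 -> hit a b c \/ exceptional a b c.
Proof.
intros hab hbc gcd1.
destruct (Z_lt_ge_dec c 60) as [c60 | c60]; [apply small_triple_hit; lia|].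
assert (gcd2 : Z.gcd (Z.gcd b c) a = 1).
  now rewrite Z.gcd_comm Z.gcd_assoc (Z.gcd_comm a b) -Z.gcd_assoc Z.gcd_comm.
unfold exceptional.
destruct (Z.eq_dec b (2 * a)); [tauto|].
destruct (Z.eq_dec c (2 * b)); [tauto|].
destruct (Z.eq_dec c (2 * a)); [tauto|].
destruct (pair_hit_or_relation a c b) as [h | [s [k [hs e]]]]; try lia.
  now left; apply hit_swap.
destruct (pair_hit_or_relation b c a) as [h | [s' [k' [hs' e']]]]; try lia.
  now left; apply hit_rot.
right.
pose proof (middle_relation a b c s k hab hbc hs e).
pose proof (lower_relation a b c s' k' hab hbc hs' e').
clear e e' hs hs'.
destruct (Z.eq_dec (a + b) c); [tauto|].
(* The only remaining common solution is proportional to 1, 5, 13; coprimality forces [a = 1],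
   contradicting [c >= 60]. *)
assert (b = 5 * a /\ c = 13 * a) as [eb ec] by lia.
assert (ad : (a | Z.gcd (Z.gcd a c) b)).
  apply Z.gcd_greatest; [apply Z.gcd_greatest|]; rewrite ?eb ?ec;
  [exists 1 | exists 13 | exists 5]; ring.
rewrite gcd1 in ad; apply Z.divide_1_r_nonneg in ad; lia.
Qed.

Lemma triple_hit (a b c : Z) : 0 < a < b -> b < c -> hit a b c \/ exceptional a b c.
Proof.
intros hab hbc.
set (g := Z.gcd (Z.gcd a c) b).
assert (g0 : 0 < g).
  pose proof (Z.gcd_nonneg (Z.gcd a c) b); pose proof (Z.gcd_eq_0_r (Z.gcd a c) b); lia.
assert (ga : (g | a)) by (transitivity (Z.gcd a c); apply Z.gcd_divide_l).
assert (gc : (g | c)).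
  transitivity (Z.gcd a c); [apply Z.gcd_divide_l | apply Z.gcd_divide_r].
assert (gb : (g | b)) by apply Z.gcd_divide_r.
destruct ga as [a' ea]; destruct gb as [b' eb]; destruct gc as [c' ec].
assert (g1 : Z.gcd (Z.gcd a' c') b' = 1).
  assert (e : g = g * Z.gcd (Z.gcd a' c') b'); [| nia].
  unfold g at 1; rewrite ea eb ec.
  rewrite !Z.gcd_mul_mono_r_nonneg; try lia.
clearbody g; subst a b c.
destruct (coprime_triple_hit a' b' c' ltac:(nia) ltac:(nia) g1) as [h | h].
  now left; apply hit_scale.
right; unfold exceptional in *; nia.
Qed.

(** One relation per triple gives a linear system; inconsistent choices are discarded early. The
    first three outcomes are [{u, 2u, v, 2v}] in its possible orders. *)
Lemma exceptional_quadruple (a b c d : Z) : 0 < a < b -> b < c < d ->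
  exceptional a b c -> exceptional a b d -> exceptional a c d -> exceptional b c d ->
  (b = 2 * a /\ d = 2 * c) \/ (c = 2 * a /\ d = 2 * b) \/ (d = 2 * a /\ c = 2 * b) \/
  (b = 2 * a /\ c = 3 * a /\ d = 4 * a) \/ (b = 2 * a /\ c = 4 * a /\ d = 5 * a) \/
  (b = 4 * a /\ c = 5 * a /\ d = 8 * a) \/ (2 * b = 3 * a /\ 2 * c = 5 * a /\ d = 5 * a).
Proof.
unfold exceptional; intros hab hbc h1 h2 h3 h4.
destruct h1 as [h1|[h1|[h1|[h1|[h1|h1]]]]];
destruct h2 as [h2|[h2|[h2|[h2|[h2|h2]]]]]; try (exfalso; clear h3 h4; lia);
destruct h3 as [h3|[h3|[h3|[h3|[h3|h3]]]]]; try (exfalso; clear h4; lia);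
destruct h4 as [h4|[h4|[h4|[h4|[h4|h4]]]]]; try (exfalso; lia);
first [left; lia | right; left; lia | do 2 right; left; lia | do 3 right; left; lia
 | do 4 right; left; lia | do 5 right; left; lia | do 6 right; lia].
Qed.

(** Reducing [K] mod [N] makes all quantities natural numbers; [n] and [k] do not depend on [a], so
    one point serves a whole triple. *)
Lemma mid_nat (N K : Z) (a : nat) : 0 < N -> mid N (K * Z.of_nat a) ->
  let n := Z.to_nat N in let k := Z.to_nat (K mod N) in
  exists u : nat, (n + 3 * (u * n) <= 3 * (k * a) < 2 * n + 3 * (u * n))%N.
Proof.
intros N0 [u hu]; cbv zeta.
pose proof (Z.div_mod K N ltac:(lia)) as eK.
pose proof (Z.mod_pos_bound K N N0) as hK.
set (q := K / N) in *; set (k := K mod N) in *; clearbody q k.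
set (v := u - q * Z.of_nat a).
assert (hv : N <= 3 * (k * Z.of_nat a - v * N) < 2 * N).
  replace (k * Z.of_nat a - v * N) with (K * Z.of_nat a - u * N); [exact hu|].
  rewrite eK; unfold v; ring.
assert (v0 : 0 <= v) by nia.
clearbody v; exists (Z.to_nat v); nia.
Qed.

(* From integer hits back to [f] and [mA] *)
Local Close Scope Z_scope.
Local Open Scope ring_scope.

Lemma f_third (R : realType) (n k a u : nat) : (0 < n)%N ->
  (n + 3 * (u * n) <= 3 * (k * a) < 2 * n + 3 * (u * n))%N ->
  f (a%:R * (k%:R / n%:R)) = 2 / 3 :> R.
Proof.
move=> n0 /andP[h1 h2].
have n0R : (0 : R) < n%:R by rewrite ltr0n.
have {h1}h1 : u%:R + 1 / 3 <= a%:R * (k%:R / n%:R) :> R.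
  rewrite mulrA ler_pdivlMr //.
  have : (n + 3 * (u * n))%:R <= (3 * (k * a))%:R :> R by rewrite ler_nat.
  rewrite natrD !natrM; lra.
have {h2}h2 : a%:R * (k%:R / n%:R) < u%:R + 2 / 3 :> R.
  rewrite mulrA ltr_pdivrMr //.
  have : (3 * (k * a))%:R < (2 * n + 3 * (u * n))%:R :> R by rewrite ltr_nat.
  rewrite natrD !natrM; lra.
have fl : Num.floor (a%:R * (k%:R / n%:R) : R) = u%:Z.
  by apply/floor_def; rewrite intrD !pmulrn; lra.
rewrite /f /fracpart fl indicE mem_set /=; first by lra.
by rewrite in_itv /= pmulrn; lra.
Qed.

Lemma f_ge (R : realType) (x : R) : - (1 / 3) <= f x.
Proof. by rewrite /f indicE; case: (_ \in _) => /=; lra. Qed.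

Lemma hit_f (R : realType) (a b c : nat) : hit (Z.of_nat a) (Z.of_nat b) (Z.of_nat c) ->
  exists x : R, [/\ f (a%:R * x) = 2 / 3, f (b%:R * x) = 2 / 3 & f (c%:R * x) = 2 / 3].
Proof.
move=> [N [K [N0 [ha [hb hc]]]]].
have n0 : (0 < Z.to_nat N)%N by lia.
exists ((Z.to_nat (K mod N))%:R / (Z.to_nat N)%:R).
have [u hu] := mid_nat N K a N0 ha.
have [v hv] := mid_nat N K b N0 hb.
have [w hw] := mid_nat N K c N0 hc.
by split; [apply: f_third hu | apply: f_third hv | apply: f_third hw].
Qed.

(** Three values [2 / 3] and a fourth that is at least [- (1 / 3)] sum to at least [5 / 3]. *)
Lemma hit_mA (R : realType) (A : {fset nat}) (a b c d : nat) :
  perm_eq A [:: a; b; c; d] -> hit (Z.of_nat a) (Z.of_nat b) (Z.of_nat c) ->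
  2 / 3 < mA R A.
Proof.
move=> pA /(hit_f R) [x [fa fb fc]].
apply: lt_le_trans (fA_le_mA A x).
rewrite /fA (perm_big _ pA) !big_cons big_nil fa fb fc /=.
by have := f_ge R (d%:R * x); lra.
Qed.

(** * Four-element sets and the conclusion *)

Lemma fset_sort4 (A : {fset nat}) : #|` A| = 4%N ->
  exists a b c d : nat, [/\ perm_eq A [:: a; b; c; d], (a < b)%N, (b < c)%N & (c < d)%N].
Proof.
move=> A4; have ss : sorted ltn (sort leq A).
  by rewrite ltn_sorted_uniq_leq sort_uniq fset_uniq sort_sorted //; apply: leq_total.
have : perm_eq A (sort leq A) by rewrite perm_sym perm_sort.
have : size (sort leq A) = 4%N by rewrite size_sort.
case: (sort leq A) ss => [|a [|b [|c [|d [|]]]]] //= /and4P[ab bc cd _] _ pA.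
by exists a, b, c, d.
Qed.

Lemma perm_fset4 (A : {fset nat}) (a b c d : nat) :
  perm_eq A [:: a; b; c; d] -> A = [fset a; b; c; d]%fset.
Proof. by move=> /perm_mem pA; apply/fsetP => x; rewrite pA !inE !orbA. Qed.

Lemma dvdn_gcd_fset (A : {fset nat}) (a b c d t : nat) :
  perm_eq A [:: a; b; c; d] -> gcd_fset A = 1%N ->
  (t %| a -> t %| b -> t %| c -> t %| d -> t = 1)%N.
Proof.
move=> pA A1 ta tb tc td; apply/eqP; rewrite -dvdn1 -A1 /gcd_fset (perm_big _ pA).
by rewrite !big_cons big_nil !dvdn_gcd ta tb tc td dvdn0.
Qed.

Theorem theorem4 (R : realType) (A : {fset nat})
    (A_pos : forall a : nat, a \in A -> (0 < a)%N)
    (A_card : #|` A| = 4%N)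
    (A_coprime : gcd_fset A = 1%N) :
  [\/ 2 / 3 < mA R A,
      exists u v : nat, [/\ (0 < u)%N, (0 < v)%N &
        A = [fset u; (2 * u)%N; v; (2 * v)%N]]
    | [\/ A = [fset 1%N; 2%N; 3%N; 4%N],
          A = [fset 1%N; 2%N; 4%N; 5%N],
          A = [fset 1%N; 4%N; 5%N; 8%N]
        | A = [fset 2%N; 3%N; 5%N; 10%N]]].
Proof.
have [a [b [c [d [pA ab bc cd]]]]] := fset_sort4 A A_card.
have a0 : (0 < a)%N by apply: A_pos; rewrite (perm_mem pA) !inE eqxx.
have hitA (s : seq nat) : perm_eq s [:: a; b; c; d] -> perm_eq A s.
  by rewrite perm_sym; apply: perm_trans.
have [h1|e1] := triple_hit (Z.of_nat a) (Z.of_nat b) (Z.of_nat c) ltac:(lia) ltac:(lia).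
  by apply: Or31; exact: (hit_mA R A a b c d pA h1).
have [h2|e2] := triple_hit (Z.of_nat a) (Z.of_nat b) (Z.of_nat d) ltac:(lia) ltac:(lia).
  apply: Or31; apply: (hit_mA R A a b d c _ h2); apply: (hitA [:: a; b; d; c]).
  rewrite !perm_cons; exact/permPl/(perm_catC [:: d] [:: c]).
have [h3|e3] := triple_hit (Z.of_nat a) (Z.of_nat c) (Z.of_nat d) ltac:(lia) ltac:(lia).
  apply: Or31; apply: (hit_mA R A a c d b _ h3); apply: (hitA [:: a; c; d; b]).
  rewrite perm_cons; exact/permPl/(perm_catC [:: c; d] [:: b]).
have [h4|e4] := triple_hit (Z.of_nat b) (Z.of_nat c) (Z.of_nat d) ltac:(lia) ltac:(lia).
  apply: Or31; apply: (hit_mA R A b c d a _ h4); apply: (hitA [:: b; c; d; a]).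
  exact/permPl/(perm_catC [:: b; c; d] [:: a]).
have dvd1 := dvdn_gcd_fset A a b c d _ pA A_coprime.
have := exceptional_quadruple (Z.of_nat a) (Z.of_nat b) (Z.of_nat c) (Z.of_nat d)
  ltac:(lia) ltac:(lia) e1 e2 e3 e4.
rewrite (perm_fset4 A a b c d pA).
case=> [[eb ed]|[[ec ed]|[[ed ec]|[[eb [ec ed]]|[[eb [ec ed]]|[[eb [ec ed]]|[eb [ec ed]]]]]]]].
- apply: Or32; exists a, c; split; [lia | lia |].
  by have [-> ->] : b = (2 * a)%N /\ d = (2 * c)%N by lia.
- apply: Or32; exists a, b; split; [lia | lia |].
  have [-> ->] : c = (2 * a)%N /\ d = (2 * b)%N by lia.
  by apply/fsetP => x; rewrite !inE; case: (x == a); case: (x == b); case: (x == _); case: (x == _).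
- apply: Or32; exists a, b; split; [lia | lia |].
  have [-> ->] : c = (2 * b)%N /\ d = (2 * a)%N by lia.
  apply/fsetP => x; rewrite !inE.
  by case: (x == a); case: (x == b); case: (x == _); case: (x == _).
- have a1 : a = 1%N.
    by apply: dvd1; rewrite ?dvdnn //; apply/dvdnP; [exists 2%N | exists 3%N | exists 4%N]; lia.
  have [-> -> -> ->] : [/\ a = 1, b = 2, c = 3 & d = 4]%N by split; lia.
  by apply: Or33; apply: Or41.
- have a1 : a = 1%N.
    by apply: dvd1; rewrite ?dvdnn //; apply/dvdnP; [exists 2%N | exists 4%N | exists 5%N]; lia.
  have [-> -> -> ->] : [/\ a = 1, b = 2, c = 4 & d = 5]%N by split; lia.
  by apply: Or33; apply: Or42.
- have a1 : a = 1%N.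
    by apply: dvd1; rewrite ?dvdnn //; apply/dvdnP; [exists 4%N | exists 5%N | exists 8%N]; lia.
  have [-> -> -> ->] : [/\ a = 1, b = 4, c = 5 & d = 8]%N by split; lia.
  by apply: Or33; apply: Or43.
(* As [2 * b = 3 * a], the difference [b - a] is half of [a], and the elements are 2, 3, 5 and 10
   times it. *)
- have t1 : (b - a)%N = 1%N.
    by apply: dvd1; apply/dvdnP; [exists 2%N | exists 3%N | exists 5%N | exists 10%N]; lia.
  have [-> -> -> ->] : [/\ a = 2, b = 3, c = 5 & d = 10]%N by split; lia.
  by apply: Or33; apply: Or44.
Qed.
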